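(* Let $\mathcal{A}_{1,1}$ be the class of axisymmetric $C^{1,1}$-surfaces in $\mathbb{R}^{3}$. Then for every $\Sigma\in\mathcal{A}_{1,1}$, $$\int_{\Sigma}|H|\,dA\geqslant\sqrt{4\pi A(\Sigma)},$$ and equality holds if and only if $\Sigma$ is a sphere. In particular, for any $A_0>0$, denoting by $\mathbb{S}_{A_0}$ the sphere of area $A_0$, $$\int_{\mathbb{S}_{A_0}}|H|\,dA=\min_{\substack{\Sigma\in\mathcal{A}_{1,1}\\ A(\Sigma)=A_0}}\int_{\Sigma}|H|\,dA=\sqrt{4\pi A_0},$$ and the sphere $\mathbb{S}_{A_0}$ is the unique global minimizer of this problem.
   Context: Axisymmetric surfaces. Let $L>0$ and let $\theta:[0,L]\to\mathbb{R}$ be Lipschitz continuous. Put, for $s\in[0,L]$, $x(s)=\int_0^s\cos\theta(t)\,dt$, $z(s)=\int_0^s\sin\theta(t)\,dt$ and $\gamma(s)=(x(s),z(s))$ (a plane curve parametrized by arc length with $\gamma(0)=(0,0)$). The map $\theta$ is called admissible if: (i) $\theta(0)=0$ and $\theta(L)=\pi$; (ii) $x(0)=x(L)=0$ and $z(L)>z(0)=0$; (iii) $\gamma$ is one-to-one on $(0,L)$ and $x(s)>0$ for every $s\in(0,L)$. An axisymmetric $C^{1,1}$-surface is a surface $\Sigma\subset\mathbb{R}^3$ obtained by rotating the curve $\gamma$ of some admissible $\theta$ (for some $L>0$) about the $z$-axis, i.e. the image of $(s,t)\in[0,L]\times[0,2\pi)\mapsto(x(s)\cos t,\,x(s)\sin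 t,\,z(s))$. The class of these surfaces is denoted $\mathcal{A}_{1,1}$. The placement of the rotation axis on the $z$-axis and of $\gamma(0)$ at the origin is a normalization of position; spheres are understood in this position (the sphere of radius $R$ corresponds to $L=\pi R$, $\theta(s)=s/R$). Curvature and area. $A$ is the two-dimensional Hausdorff measure (area), and $dA=2\pi x(s)\,ds$ on $\Sigma$. The orientation is by the outer unit normal, with the sign convention that a sphere of radius $R$ has principal curvatures $1/R$. The principal curvatures exist almost everywhere and are $\kappa_1(s)=\sin\theta(s)/x(s)$ and $\kappa_2(s)=\dot\theta(s)$ for a.e. $s\in[0,L]$; the scalar mean curvature is $H=\frac12(\kappa_1+\kappa_2)$. Thus $$\int_\Sigma |H|\,dA=\pi\int_0^L\left|\sin\theta(s)+\dot\theta(s)x(s)\right|ds,\qquad A(\Sigma)=2\pi\int_0^L x(s)\,ds.$$ *)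

(* Defs.v *)
From HB Require Import structures.
From mathcomp Require Import all_boot all_order all_algebra.
From mathcomp Require Import all_classical all_reals all_analysis.

Set Implicit Arguments.
Unset Strict Implicit.
Unset Printing Implicit Defensive.

Import Order.TTheory GRing.Theory Num.Theory.
Import numFieldNormedType.Exports.

Local Open Scope classical_set_scope.
Local Open Scope ring_scope.

Section GeneratingCurve.
Context {R : realType}.
Implicit Types (L s t : R) (theta : R -> R).

Local Notation mu := (@lebesgue_measure R).

Definition curve_x theta s : R := \int[mu]_(t in `[0, s]) cos (theta t).

Definition curve_z theta s : R := \int[mu]_(t in `[0, s]) sin (theta t).

Definition curve theta s : R * R := (curve_x theta s, curve_z theta s).

(* An angle function is a map on `[0, L]; it is represented by a total
   function, whose values outside `[0, L] are irrelevant. *)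
Record admissible L theta : Prop := Admissible {
  length_gt0 : 0 < L ;
  angle_lipschitz : [lipschitz theta s | s in `[0, L]] ;
  angle_start : theta 0 = 0 ;
  angle_end : theta L = pi ;
  curve_x_start : curve_x theta 0 = 0 ;
  curve_x_end : curve_x theta L = 0 ;
  curve_z_start : curve_z theta 0 = 0 ;
  curve_z_end : 0 < curve_z theta L ;
  curve_inj : {in `]0, L[ &, injective (curve theta)} ;
  curve_x_gt0 : {in `]0, L[, forall s, 0 < curve_x theta s} }.

Definition rotation theta (p : R * R) : R * R * R :=
  (curve_x theta p.1 * cos p.2, curve_x theta p.1 * sin p.2,
   curve_z theta p.1).

(* kappa1 is only meaningful on `]0, L[ and kappa2 only at points of
   differentiability of theta, i.e. almost everywhere; the values given
   elsewhere by the total operations _^-1 and derive1 are irrelevant. *)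
Definition kappa1 theta s : R := sin (theta s) / curve_x theta s.

Definition kappa2 theta s : R := derive1 theta s.

Definition mean_curvature theta s : R := (kappa1 theta s + kappa2 theta s) / 2.

End GeneratingCurve.

(* A surface of the class A_{1,1}, given with a generating curve; as a point
   set it is [carrier S], and surfaces are compared through their carriers. *)
Record axisym_surface (R : realType) := AxisymSurface {
  len : R ;
  angle : R -> R ;
  admissible_angle : admissible len angle }.

Section Surface.
Context {R : realType}.
Implicit Types (S : axisym_surface R) (r : R).

Local Notation mu := (@lebesgue_measure R).

Definition carrier S : set (R * R * R) :=
  rotation (angle S) @` (`[0, len S] `*` `[0, 2 * pi[).

(* integral over the surface of a rotation-invariant function, expressed as a
   function f of arc length, with area element dA = 2 pi x(s) ds *)
Definition surface_integral S (f : R -> R) : R :=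
  \int[mu]_(s in `[0, len S]) (f s * (2 * pi * curve_x (angle S) s)).

Definition area S : R := surface_integral S (fun=> 1).

Definition total_abs_mean_curvature S : R :=
  surface_integral S (fun s => `|mean_curvature (angle S) s|).

(* the sphere of radius r through the origin, centred at (0, 0, r) *)
Definition axial_sphere r : set (R * R * R) :=
  [set p | p.1.1 ^+ 2 + p.1.2 ^+ 2 + (p.2 - r) ^+ 2 = r ^+ 2].

Definition is_sphere (Sigma : set (R * R * R)) : Prop :=
  exists2 r, 0 < r & Sigma = axial_sphere r.

End Surface.

(* Main.v *)
(** Fold the angle into [0, pi]: with t := acos (cos theta), cos t = cos theta
    and |sin theta + theta' x| >= sin t + t' x almost everywhere. By strict
    convexity of c |-> sin (acos c) - c acos c on [-1, 1],
    D := (sin t - t cos theta) - (sin phi - phi cos theta) >= 0 for the angle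
    phi s := pi s / L of the sphere of the same length, so that
      |sin theta + theta' x| >= ((t - phi) x)' + sin phi + (pi / L) x + D.
    Integrating (x vanishes at both ends) and multiplying by pi yields
      int |H| dA >= 2 L + pi A / (2 L) + pi int D >= sqrt (4 pi A) + pi int D
    by AM-GM. Equality forces D = 0, hence t = phi, hence theta = phi. *)

Require Import Defs.
From HB Require Import structures.
From mathcomp Require Import all_boot all_order all_algebra.
From mathcomp Require Import all_classical all_reals all_analysis.
From mathcomp Require Import measurable_realfun.
From mathcomp Require Import ring lra.

Set Implicit Arguments.
Unset Strict Implicit.
Unset Printing Implicit Defensive.

Import Order.TTheory GRing.Theory Num.Theory.
Import numFieldNormedType.Exports.
Local Open Scope classical_set_scope.
Local Open Scope ring_scope.

(** * Lipschitz functions on the line *)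

Section Lipschitz.
Context {R : realType}.
Implicit Types (f g : R -> R) (a b : R).

(** Convexity only controls angles in [[0, pi]], and nothing keeps [theta] there. Folding brings it
    back at the price of corners, so even a smooth [theta] leads to a function that is merely
    Lipschitz. Hence the analytic core: a Lipschitz function is almost everywhere differentiable and
    is recovered by integrating its derivative. The comparison angle [phi] belongs to the sphere
    with the same meridian length, not the same area. Since [phi] is linear and [cos theta] is the
    derivative of [x], integrating [phi * cos theta] by parts produces a multiple of the area. The
    unknown [L] is then eliminated by AM-GM, because the product of the two terms [2 * L] and
    [pi * A / (2 * L)] is free of it. The integrand of the mean curvature is built from [derive1],
    which has default values, and is not shown to be measurable; the comparison of integrals is
    designed for such a majorant. A sphere is known only as a point set, so for the converse the
    angle has to be reconstructed from the carrier. *)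

Lemma lipschitz_within_continuous (A : set R) (g : R -> R) M :
  (forall x y, A x -> A y -> `|g x - g y| <= M * `|x - y|) ->
  {within A, continuous g}.
Proof.
move=> gM; apply/subspace_continuousP => x Ax; apply/cvgrPdist_lt => e e0.
have M1 : 0 < `|M| + 1 by rewrite ltr_pwDr.
rewrite near_withinE; near=> y => Ay.
apply: (@le_lt_trans _ _ ((`|M| + 1) * `|x - y|)).
  by rewrite (le_trans (gM _ _ Ax Ay))// ler_wpM2r// (le_trans (ler_norm _))// lerDl.
rewrite mulrC -ltr_pdivlMr//; near: y.
by apply: cvgr_dist_lt; rewrite ?divr_gt0.
Unshelve. all: by end_near. Qed.

(** The notation asks for the bound with all large constants; a single constant of any sign is the
    form used in the estimates. *)
Lemma lipschitzP (f : R -> R) (A : set R) :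
  [lipschitz f s | s in A] <->
  exists M, forall x y, A x -> A y -> `|f x - f y| <= M * `|x - y|.
Proof.
split=> [/pinfty_ex_gt0[M _ fM]|[M fM]].
  by exists M => x y Ax Ay; exact: (fM (x, y)).
rewrite /lipschitz_on; near=> K => -[x y] [/= Ax Ay].
by rewrite (le_trans (fM _ _ Ax Ay))// ler_wpM2r//; near: K; exact: nbhs_pinfty_ge.
Unshelve. all: by end_near. Qed.

Lemma lipschitz_subr f g (A : set R) : [lipschitz f s | s in A] ->
  [lipschitz g s | s in A] -> [lipschitz f s - g s | s in A].
Proof.
move=> /lipschitzP[M fM] /lipschitzP[N gN]; apply/lipschitzP.
exists (M + N) => x y Ax Ay; have := fM _ _ Ax Ay; have := gN _ _ Ax Ay.
have -> : f x - g x - (f y - g y) = (f x - f y) - (g x - g y) by ring.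
by rewrite mulrDl => ? ?; rewrite (le_trans (ler_normB _ _))// lerD.
Qed.

Lemma lipschitz_bounded_itv f a b : [lipschitz f s | s in `[a, b]] ->
  exists C, {in `[a, b], forall x, `|f x| <= C}.
Proof.
move=> /lipschitzP[M fM]; exists (`|f a| + `|M| * (b - a)) => x xab.
have : a <= x <= b by rewrite in_itv in xab.
move=> /andP[ax xb]; rewrite -[f x](subrK (f a)) addrC.
rewrite (le_trans (ler_normD _ _))// lerD2l.
have aab : `[a, b]%classic a by rewrite /= in_itv/= lexx (le_trans ax xb).
rewrite (le_trans (fM _ _ xab aab))//.
apply: (@le_trans _ _ (`|M| * `|x - a|)); first by rewrite ler_wpM2r// ler_norm.
by rewrite ler_wpM2l// ger0_norm ?subr_ge0// lerD2r.
Qed.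

Lemma lipschitz_mulr f g a b : [lipschitz f s | s in `[a, b]] ->
  [lipschitz g s | s in `[a, b]] -> [lipschitz f s * g s | s in `[a, b]].
Proof.
move=> lf lg; have [C fC] := lipschitz_bounded_itv lf.
have [E gE] := lipschitz_bounded_itv lg.
move: lf lg => /lipschitzP[M fM] /lipschitzP[N gN]; apply/lipschitzP.
exists (C * N + E * M) => x y Ax Ay; have := fM _ _ Ax Ay; have := gN _ _ Ax Ay.
have -> : f x * g x - f y * g y = f x * (g x - g y) + g y * (f x - f y) by ring.
move=> gxy fxy; rewrite (le_trans (ler_normD _ _))// !normrM mulrDl -!mulrA.
by rewrite lerD// ler_pM// ?fC ?gE.
Qed.

Lemma lipschitz_cos_scale (c : R) (A : set R) : [lipschitz cos (c * s) | s in A].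
Proof.
apply/lipschitzP; exists `|c| => x y _ _.
wlog xy : x y / c * x <= c * y.
  move=> H; have [xy|/ltW yx] := leP (c * x) (c * y); first exact: H.
  by rewrite distrC (distrC x); exact: H.
have [z _ E] : exists2 z, z \in `[c * x, c * y] &
    cos (c * y) - cos (c * x) = - sin z * (c * y - c * x).
  apply: (@MVT_segment _ cos (fun z => - sin z)) => //.
  exact/continuous_subspaceT/continuous_cos.
rewrite distrC E -mulrBr !normrM normrN distrC ler_piMl ?mulr_ge0//.
exact: sin_max.
Qed.

Lemma lipschitz_scale (c : R) (A : set R) : [lipschitz c * s | s in A].
Proof.
by apply/lipschitzP; exists `|c| => x y _ _; rewrite -mulrBr normrM.
Qed.

End Lipschitz.

(** * Almost everywhere differentiability of Lipschitz functions *)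

Section LipschitzDerivative.
Context {R : realType}.
Local Notation mu := (@lebesgue_measure R).

(** The difference quotients compare in absolute value, and so do their limits. With a linear [f]
    this bounds the derivative of a Lipschitz function; with [g] the folded angle it compares the
    derivatives before and after folding. *)
Lemma derivative_le (f g : R -> R) (s df dg : R) :
  is_derive s 1 f df -> is_derive s 1 g dg ->
  (\forall y \near s, `|g y - g s| <= `|f y - f s|) -> `|dg| <= `|df|.
Proof.
move=> [fs <-] [gs <-] gf.
have /cvg_norm fn := fs; have /cvg_norm gn := gs.
apply: (ler_cvg_to gn fn).
have hs : (h *: 1 + s) @[h --> (0 : R)^'] --> s.
  have -> : nbhs s = nbhs (0 *: 1 + s) by rewrite scale0r add0r.
  apply: cvg_within_filter; apply: cvgD; last exact: cvg_cst.
  by apply: cvgZr_tmp; exact: cvg_id.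
by near=> h; rewrite /= !normrM ler_wpM2l//; near: h; exact: (hs _ gf).
Unshelve. all: by end_near. Qed.

Lemma lipschitz_derivative_le (f : R -> R) (M s df : R) : is_derive s 1 f df ->
  (\forall y \near s, `|f y - f s| <= M * `|y - s|) -> `|df| <= `|M|.
Proof.
move=> fd fM.
have dM : is_derive s (1 : R) (M \*: id) (M *: (1 : R)) by exact: is_deriveZ.
have := derivative_le dM fd; rewrite /GRing.scale/= mulr1; apply.
apply: filterS fM => y fM; rewrite (le_trans fM)//.
by rewrite -[leRHS]/(`|M * y - M * s|) -mulrBr normrM ler_wpM2r// ler_norm.
Qed.

(* Where [f] is not differentiable, [derive1 f] takes the junk value [point]. *)
Lemma derive1_lipschitz_le (f : R -> R) M s :
  (\forall y \near s, `|f y - f s| <= M * `|y - s|) ->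
  `|derive1 f s| <= `|M| + `|point : R|.
Proof.
move=> fM; have [fs|fs] := pselect (derivable f s 1).
  have fd : is_derive s 1 f (derive1 f s) by apply: DeriveDef => //; rewrite derive1E.
  by apply: le_trans (lipschitz_derivative_le fd fM) _; rewrite lerDl.
by rewrite derive1E /derive dvgP// lerDr.
Qed.

Lemma lebesgue_stieltjes_itvoc (g : cumulative R R) x y : x <= y ->
  lebesgue_stieltjes_measure g `]x, y] = (g y - g x)%:E.
Proof.
move=> xy; rewrite /lebesgue_stieltjes_measure /measure_extension.
by rewrite measurable_mu_extE/= ?wlength_itv_bnd//; exact: is_ocitv.
Qed.

(* The Stieltjes measures of [g] and of [h x := (M + 1) x - g x] add up to
   [M + 1] times the Lebesgue measure, so the former has a density. *)
Lemma increment_lebesgue_integral (g : R -> R) M a b : a < b ->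
  (forall x y, x <= y -> 0 <= g y - g x <= M * (y - x)) ->
  exists d : R -> R, [/\ mu.-integrable setT (EFin \o d) &
    forall x, a <= x <= b ->
      (\int[mu]_(t in `]a, x]) (d t)%:E = (g x - g a)%:E)%E].
Proof.
move=> ab gM.
have M0 : 0 <= M.
  have /andP[h1 h2] := gM _ _ (ltW ab).
  by move: (le_trans h1 h2); rewrite pmulr_lge0// subr_gt0.
have nd x y : x <= y -> g x <= g y.
  by move=> /gM/andP[+ _]; rewrite subr_ge0.
have gc : continuous g.
  apply/continuous_subspace_setT.
  apply: (@lipschitz_within_continuous _ _ _ M) => x y _ _.
  have [xy|/ltW yx] := leP x y.
    have /andP[] := gM _ _ xy; rewrite ler0_norm ?subr_le0 ?nd//.
    by rewrite (ler0_norm (_ : x - y <= 0)) ?subr_le0// !opprB.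
  have /andP[] := gM _ _ yx; rewrite ger0_norm ?subr_ge0 ?nd//.
  by rewrite (ger0_norm (_ : 0 <= x - y)) ?subr_ge0.
(* The slope [M + 1] rather than [M] keeps the factor of the Lebesgue measure positive, hence
   invertible, when [M = 0]. *)
pose h x := (M + 1) * x - g x.
have hnd x y : x <= y -> h x <= h y.
  by move=> xy; have /andP[_] := gM _ _ xy; rewrite /h; nra.
have hc : continuous h.
  move=> x; apply: cvgB; last exact: gc.
  by apply: cvgM; [exact: cvg_cst|exact: cvg_id].
pose gC := HB.pack_for (cumulative R R) g
  (isCumulative.Build R _ R g nd (right_continuousW gc)).
pose hC := HB.pack_for (cumulative R R) h
  (isCumulative.Build R _ R h hnd (right_continuousW hc)).
have M1 : 0 <= (M + 1)^-1 by rewrite invr_ge0 addr_ge0.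
pose nu := mscale (NngNum M1)
  (measure_add (lebesgue_stieltjes_measure gC) (lebesgue_stieltjes_measure hC)).
have nuAE A : nu A = ((M + 1)^-1%:E * (lebesgue_stieltjes_measure gC A +
    lebesgue_stieltjes_measure hC A))%E.
  by congr (_ * _)%E; exact: measure_addE.
have nuE : forall A, measurable A -> mu A = nu A.
  apply: lebesgue_measure_unique => X [[x y] _ <-] /=.
  have [xy|yx] := leP x y; last first.
    by rewrite set_itv_ge ?bnd_simp -?leNgt ?ltW// !measure0.
  apply: etrans (esym (nuAE _)); rewrite !lebesgue_stieltjes_itvoc// /lebesgue_measure.
  rewrite lebesgue_stieltjes_itvoc// -EFinD -EFinM /= /h; congr EFin.
  by field; rewrite gt_eqF// ltr_pwDr.
have dom : lebesgue_stieltjes_measure gC `<< mu.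
  move=> N N0 A mA AN; have := N0 A mA AN; rewrite nuE//.
  rewrite nuAE => /eqP; rewrite mule_eq0.
  rewrite eqe invr_eq0 gt_eqF ?ltr_pwDr//= padde_eq0//.
  by move=> /andP[/eqP].
have mab : measurable (`]a, b] : set (measurableTypeR R)) by exact: measurable_itv.
(* Radon-Nikodym is applied to the restriction to []a, b]], which is a finite measure; the density
   is then integrable on the whole line. *)
have fin : (lebesgue_stieltjes_measure gC `]a, b] < +oo)%E.
  by rewrite lebesgue_stieltjes_itvoc ?ltry// ltW.
have [|f [f0 ffin intf fE]] := @radon_nikodym_sigma_finite _ _ _
  (@lebesgue_measure R) (mfrestr mab fin).
  move=> N N0 A mA AN; rewrite /mfrestr /mrestr.
  by apply: (dom _ N0); [exact: measurableI|exact: subset_trans AN].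
exists (fine \o f).
have fineE : EFin \o (fine \o f) = f.
  by apply/funext => x /=; rewrite fineK.
split; first by rewrite fineE.
move=> x /andP[ax xb].
under eq_integral do rewrite fineK//.
rewrite -fE//= /mfrestr /mrestr.
rewrite setIidl; last by apply: subset_itvl; rewrite bnd_simp.
by rewrite lebesgue_stieltjes_itvoc.
Qed.
(** Rademacher's theorem in dimension one, with the fundamental theorem of calculus. Adding [K]
    times the identity makes [f] nondecreasing, so the previous lemma writes its increments as
    integrals of a density, and Lebesgue differentiation makes that density a derivative almost
    everywhere. *)
Lemma lipschitz_ae_derivable (f : R -> R) (K a b : R) : a < b ->
  {in `[a, b] &, forall x y, `|f x - f y| <= K * `|x - y|} ->
  exists d : R -> R, [/\ measurable_fun setT d, forall s, `|d s| <= K,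
    \int[mu]_(t in `[a, b]) d t = f b - f a &
    {ae mu, forall s, a < s < b -> is_derive s 1 f (d s)}].
Proof.
move=> ab fK.
have K0 : 0 <= K.
  have := fK a b; rewrite !in_itv/= !lexx ltW//= => /(_ isT isT).
  move/(le_trans (normr_ge0 _)); rewrite pmulr_lge0//.
  by rewrite normr_gt0 subr_eq0 lt_eqF.
(* Clamping to [[a, b]] extends [f] to the line with the same Lipschitz constant, since the
   increments are to be bounded globally. *)
pose c x := Num.max a (Num.min x b).
have cab x : c x \in `[a, b].
  by rewrite in_itv/= /c le_max lexx/= ge_max ltW//= ge_min lexx orbT.
have cE x : a <= x <= b -> c x = x.
  by move=> /andP[ax xb]; rewrite /c (min_idPl _)// (max_idPr _).
have cM x y : x <= y -> 0 <= c y - c x <= y - x.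
  move=> xy; rewrite /c; have ab' := ltW ab.
  case: (leP x b) => xb; case: (leP y b) => yb; rewrite ?(max_idPr ab');
    case: (leP a x) => ax; case: (leP a y) => ay; apply/andP; split; lra.
pose g x := f (c x) + K * c x.
have gM x y : x <= y -> 0 <= g y - g x <= (2 * K) * (y - x).
  move=> xy; have /andP[c0 c1] := cM _ _ xy.
  have := fK _ _ (cab y) (cab x); rewrite (ger0_norm c0) ler_norml /g.
  by move=> /andP[h1 h2]; apply/andP; split; nra.
have [d0 [id0 d0E]] := increment_lebesgue_integral ab gM.
have id0S A : measurable A -> mu.-integrable A (EFin \o d0).
  by move=> mA; exact: integrableS id0.
have d0r x : a <= x <= b -> \int[mu]_(t in `]a, x]) d0 t = g x - g a.
  by move=> axb; rewrite /Rintegral d0E.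
have md0 : measurable_fun setT d0.
  by apply/measurable_EFinP; case/integrableP : id0.
have md0K : measurable_fun setT (fun s => d0 s - K).
  by apply: measurable_funB; [exact: md0|exact: measurable_cst].
(* The density is determined only almost everywhere. Truncation enforces [|d s| <= K] at every point
   and changes nothing where [d0 s - K] is the derivative of [f], which is itself bounded by [K]. *)
pose d s := Num.max (- K) (Num.min (d0 s - K) K).
have md : measurable_fun setT d.
  apply: measurable_maxr; first exact: measurable_cst.
  by apply: measurable_minr; [exact: md0K|exact: measurable_cst].
have dK s : `|d s| <= K.
  rewrite ler_norml /d le_max lexx/= ge_max ge_min lexx orbT andbT.
  by rewrite -subr_ge0 opprK addr_ge0.
have aed : {ae mu, forall s, a < s < b ->
    is_derive s 1 f (d s) /\ d s = d0 s - K}.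
  have := @FTC1 R d0 (BRight a) (fun y => id0S _ (measurable_itv _))
    (open_integrable_locally openT id0).
  apply: filterS; first exact: (ae_filter_ringOfSetsType mu).
  move=> s Fs /andP[as_ sb].
  have [dF F's] := Fs as_.
  have sK : is_derive s 1 f (d0 s - K).
    have dF' : is_derive s 1 (fun y => \int[mu]_(t in `]a, y]) d0 t) (d0 s).
      by apply: DeriveDef => //; rewrite -derive1E F's.
    apply: (@near_eq_is_derive _ _ _
      ((fun y => \int[mu]_(t in `]a, y]) d0 t) - (K \*: id) + cst (g a))).
      near=> y.
      have axb : a <= y <= b.
        by apply/andP; split; apply: ltW; near: y; [exact: lt_nbhsr|exact: lt_nbhsl].
      rewrite !fctE/= d0r// /g cE// /GRing.scale/=; ring.
    have -> : d0 s - K = d0 s - K *: 1 + 0 by rewrite addr0 /GRing.scale/= mulr1.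
    exact: is_deriveD.
  have lip : `|d0 s - K| <= K.
    rewrite -[leRHS](ger0_norm K0); apply: lipschitz_derivative_le sK _.
    near=> y; apply: fK; rewrite in_itv/=; last by rewrite !ltW.
    by apply/andP; split; apply: ltW; near: y; [exact: lt_nbhsr|exact: lt_nbhsl].
  have dsE : d s = d0 s - K.
    move: lip; rewrite ler_norml => /andP[h1 h2].
    by rewrite /d (min_idPl _)// (max_idPr _).
  by rewrite dsE.
exists d; split => //.
- have muab : mu `]a, b] = (b - a)%:E.
    by rewrite lebesgue_measure_itv/= lte_fin ab.
  have id0K : mu.-integrable `]a, b] (EFin \o cst K).
    apply: measurable_bounded_integrable => //.
    - by apply: (le_lt_trans _ (ltry (b - a))); rewrite -muab.
    - exact: bounded_cst.
  transitivity (\int[mu]_(t in `]a, b]) (d0 t - K)).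
    rewrite /Rintegral; congr fine.
    rewrite integral_itv_bndoo; last by apply: measurable_funTS; exact/measurable_EFinP.
    rewrite [RHS]integral_itv_bndoo; last first.
      by apply: measurable_funTS; exact/measurable_EFinP.
    apply: ae_eq_integral => //.
    - by apply: measurable_funTS; exact/measurable_EFinP.
    - by apply: measurable_funTS; exact/measurable_EFinP.
    apply: filterS aed; first exact: (ae_filter_ringOfSetsType mu).
    by move=> s /[swap]; rewrite /= in_itv/= => asb /(_ asb) [_ ->].
  rewrite RintegralB//; last exact: id0S.
  have -> : \int[mu]_(t in `]a, b]) K = K * (b - a).
    transitivity (K * fine (mu `]a, b])); first exact: Rintegral_cst.
    by rewrite muab.
  rewrite d0r ?lexx ?ltW//.
  by rewrite /g !cE ?lexx ?ltW//; ring.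
- apply: filterS aed; first exact: (ae_filter_ringOfSetsType mu).
  by move=> s aed asb; case: (aed asb).
Unshelve. all: by end_near. Qed.

End LipschitzDerivative.

(** * Integrals on segments *)

Section Integrals.
Context {R : realType}.
Local Notation mu := (@lebesgue_measure R).

Lemma within_itv_integrable (f : R -> R) (a b : R) :
  {within `[a, b], continuous f} -> mu.-integrable `[a, b] (EFin \o f).
Proof. by move=> cf; apply: continuous_compact_integrable => //; exact: segment_compact. Qed.

Lemma is_derive_primitive (f : R -> R) (L s : R) :
  {within `[0, L], continuous f} -> 0 < s < L ->
  is_derive s 1 (fun x => \int[mu]_(t in `[0, x]) f t) (f s).
Proof.
move=> cf /andP[s0 sL].
have [|dF F's] := continuous_FTC1_closed sL (within_itv_integrable cf) s0.
  apply: (within_continuous_continuous (lt_trans s0 sL) cf).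
  by rewrite in_itv/= s0.
by apply: DeriveDef => //; rewrite -derive1E.
Qed.

Lemma primitive_continuous (f : R -> R) (L : R) : 0 <= L ->
  {within `[0, L], continuous f} ->
  {within `[0, L], continuous (fun x => \int[mu]_(t in `[0, x]) f t)}.
Proof.
by move=> L0 cf; apply: parameterized_integral_continuous => //; exact: within_itv_integrable.
Qed.

Lemma primitive_lipschitz (f : R -> R) (L : R) : 0 <= L ->
  {within `[0, L], continuous f} -> (forall s, `|f s| <= 1) ->
  {in `[0, L] &, forall x y, `|\int[mu]_(t in `[0, x]) f t -
    \int[mu]_(t in `[0, y]) f t| <= `|x - y|}.
Proof.
move=> L0 cf f1 x y.
wlog xy : x y / x <= y.
  move=> H xL yL; have [xy|/ltW yx] := leP x y; first exact: H.
  by rewrite distrC (distrC x); exact: H.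
rewrite !in_itv/= => /andP[x0 xL] /andP[y0 yL].
have [c _ E] : exists2 c, c \in `[x, y] & \int[mu]_(t in `[0, y]) f t -
    \int[mu]_(t in `[0, x]) f t = f c * (y - x).
  apply: (@MVT_segment _ (fun z => \int[mu]_(t in `[0, z]) f t) f) => //.
    move=> c; rewrite in_itv/= => /andP[xc cy].
    apply: is_derive_primitive cf _.
    by rewrite (le_lt_trans x0 xc) (lt_le_trans cy yL).
  apply: continuous_subspaceW (primitive_continuous L0 cf).
  by apply: subset_itv; rewrite bnd_simp.
rewrite distrC E normrM distrC ler_piMl//.
Qed.

(* Unlike [ge0_le_integral], this assumes no measurability. *)
Lemma ge0_le_integral_dom (D : set R) (f h : R -> \bar R) :
  (forall x, D x -> (0 <= f x)%E) -> (forall x, D x -> (f x <= h x)%E) ->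
  (\int[mu]_(x in D) f x <= \int[mu]_(x in D) h x)%E.
Proof.
move=> f0 fh.
have h0 x : D x -> (0 <= h x)%E by move=> Dx; rewrite (le_trans (f0 x Dx))// fh.
rewrite !ge0_integralE//; apply: le_ereal_sup => _ [k /= kf <-]; exists k => // x.
apply: le_trans (kf x) _; rewrite !patchE.
by case: ifPn => //; rewrite inE; exact: fh.
Qed.

(** Measurability is asked of the smaller function alone: its integral may ignore the exceptional
    null set, and off that set the domination is pointwise. *)
Lemma ae_ge0_le_integralr (D : set R) (g h : R -> \bar R) :
  measurable D -> measurable_fun D g -> (forall x, D x -> (0 <= g x)%E) ->
  (forall x, D x -> (0 <= h x)%E) -> {ae mu, forall x, D x -> (g x <= h x)%E} ->
  (\int[mu]_(x in D) g x <= \int[mu]_(x in D) h x)%E.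
Proof.
move=> mD mg g0 h0 [N [mN muN0 gh]].
rewrite (ge0_negligible_integral mN)//.
rewrite integral_mkcond [leRHS]integral_mkcond.
apply: ge0_le_integral_dom => x _; rewrite !patchE; case: ifPn => //.
- by rewrite inE => -[Dx _]; exact: g0.
- rewrite inE => -[Dx Nx]; rewrite mem_set//.
  by apply: contrapT => gh'; apply: Nx; apply: gh => /(_ Dx).
- by move=> _; case: ifPn => //; rewrite inE; exact: h0.
Qed.
Lemma ae_neq (c : R) : {ae mu, forall s, s != c}.
Proof.
exists [set c]; split => //; first exact: lebesgue_measure_set1.
by move=> s /= /negP; rewrite negbK => /eqP.
Qed.

Lemma lebesgue_measure_itv_lty (a b : R) : (mu `[a, b] < +oo)%E.
Proof. by rewrite lebesgue_measure_itv/=; case: ifP; rewrite ltry. Qed.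

Lemma bounded_itv_integrable (f : R -> R) (a b C : R) :
  measurable_fun `[a, b] f -> {in `[a, b], forall s, `|f s| <= C} ->
  mu.-integrable `[a, b] (EFin \o f).
Proof.
move=> mf fC; apply: measurable_bounded_integrable => //.
  exact: lebesgue_measure_itv_lty.
exists C; split; first exact: num_real.
by move=> M CM x xab; apply: le_trans (fC _ xab) _; exact: ltW.
Qed.

Lemma integrableZl_EFin (D : set R) (k : R) (f : R -> R) : measurable D ->
  mu.-integrable D (EFin \o f) -> mu.-integrable D (EFin \o (fun s => k * f s)).
Proof.
move=> mD intf; rewrite (_ : EFin \o _ = fun s => (k%:E * (EFin \o f) s)%E)//.
exact: integrableZl.
Qed.

Lemma integrableD_EFin (D : set R) (f g : R -> R) : measurable D ->
  mu.-integrable D (EFin \o f) -> mu.-integrable D (EFin \o g) ->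
  mu.-integrable D (EFin \o (fun s => f s + g s)).
Proof.
move=> mD intf intg.
rewrite (_ : EFin \o _ = ((EFin \o f) \+ (EFin \o g))%E)//.
exact: integrableD.
Qed.

(* [h] will be the mean curvature integrand, whose measurability is not at hand;
   the bound [C] only serves to keep its integral finite. *)
Lemma ae_le_Rintegral_itv (g h : R -> R) (a b C : R) :
  mu.-integrable `[a, b] (EFin \o g) ->
  {in `[a, b], forall s, 0 <= h s <= C} ->
  {ae mu, forall s, a < s < b -> g s <= h s} ->
  \int[mu]_(s in `[a, b]) g s <= \int[mu]_(s in `[a, b]) h s.
Proof.
move=> ig hC gh.
have mg : measurable_fun `[a, b] g.
  by apply/measurable_EFinP; case/integrableP : ig.
(* As [h] is nonnegative, it also dominates the positive part of [g], to which the comparison of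
   nonnegative integrals applies. *)
pose gp s := Num.max (g s) 0.
have igp : mu.-integrable `[a, b] (EFin \o gp).
  rewrite (_ : EFin \o gp = (EFin \o g)^\+)%E; first exact: integrable_funepos.
  by apply/funext => s; rewrite funeposE /gp /= EFin_max.
apply: (@le_trans _ _ (\int[mu]_(s in `[a, b]) gp s)).
  by apply: le_Rintegral => // s _; rewrite /gp le_max lexx.
have le_gph : (\int[mu]_(s in `[a, b]) (gp s)%:E <=
    \int[mu]_(s in `[a, b]) (h s)%:E)%E.
  apply: ae_ge0_le_integralr => //.
  - by case/integrableP : igp.
  - by move=> s _; rewrite lee_fin /gp le_max lexx orbT.
  - by move=> s sab; have /andP[] := hC _ sab.
  have aeF : Filter (nbhs (almost_everywhere mu)).
    exact: ae_filter_ringOfSetsType.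
  apply: filterS3 gh (ae_neq a) (ae_neq b).
  move=> s gh sa sb; rewrite /= in_itv/= => /andP[as_ sb_].
  rewrite lee_fin /gp ge_max gh/=; last by rewrite !lt_neqAle sb sb_ eq_sym sa as_.
  have sab : s \in `[a, b] by rewrite in_itv/= as_.
  by have /andP[] := hC _ sab.
rewrite /Rintegral fine_le//; first exact: integrable_fin_num.
rewrite ge0_fin_numE; last first.
  by apply: integral_ge0 => s sab; have /andP[] := hC _ sab.
apply: (@le_lt_trans _ _ (\int[mu]_(s in `[a, b]) (C%:E))%E).
  apply: ge0_le_integral_dom => s sab; have /andP[h0 hs] := hC _ sab.
    by rewrite lee_fin.
  by rewrite lee_fin.
rewrite -ge0_fin_numE; last first.
  apply: integral_ge0 => s sab; have /andP[h0 hs] := hC _ sab.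
  by rewrite lee_fin (le_trans h0).
apply: integrable_fin_num => //; apply: (@bounded_itv_integrable _ _ _ `|C|).
  exact: measurable_cst.
by [].
Qed.

End Integrals.

(** * Folded angles *)

Section Trigonometry.
Context {R : realType}.
Implicit Types u v : R.

Lemma acos_cos_itv u : 0 <= acos (cos u) <= pi.
Proof. by rewrite acos_ge0 ?acos_lepi// cos_geN1 cos_le1. Qed.

Lemma cos_acos_cos u : cos (acos (cos u)) = cos u.
Proof. by rewrite acosK// in_itv/= cos_geN1 cos_le1. Qed.

Lemma sin_acos_cos u : sin (acos (cos u)) = `|sin u|.
Proof.
by rewrite sin_acos ?cos_geN1 ?cos_le1// -sin2cos2 sqrtr_sqr.
Qed.

(** For [|u - v| < pi] compare cosines, which decrease on [[0, pi]]: [cos (u - v)] is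
    [cos u * cos v + sin u * sin v], and folding replaces the last product by its absolute value.
    Otherwise the two folded angles differ by at most [pi]. *)
Lemma acos_cos_lipschitz u v : `|acos (cos u) - acos (cos v)| <= `|u - v|.
Proof.
have /andP[p0 p1] := acos_cos_itv u; have /andP[q0 q1] := acos_cos_itv v.
have [uvpi|uvpi] := leP pi `|u - v|.
  by apply: le_trans uvpi; rewrite ler_norml; apply/andP; split; lra.
rewrite leNgt -ltr_cos ?in_itv/= ?normr_ge0 ?(ltW uvpi)//; last first.
  by rewrite ler_norml; apply/andP; split; lra.
rewrite !cos_norm !cosB -leNgt !cos_acos_cos !sin_acos_cos lerD2l.
by rewrite -normrM ler_norm.
Qed.

(* On [-1, 1] the function [c |-> sin (acos c) - c * acos c] is strictly
   convex; this is the inequality with its tangent at [cos v]. *)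
Lemma sin_sub_cos_tangent u v : 0 <= u <= pi -> 0 <= v <= pi ->
  sin v - v * cos u <= sin u - u * cos u ?= iff (u == v).
Proof.
move=> u0 v0; apply/leifP; have [->//|uv] := eqVneq u v.
(* By the mean value theorem this quantity is [(cos c - cos u) * (u - v)] with [c] strictly between
   [u] and [v], and [cos] decreases strictly on [[0, pi]]. *)
suff : 0 < (sin u - sin v) - cos u * (u - v) by lra.
have sinE (x y : R) : x < y -> exists2 c, c \in `]x, y[ & sin y - sin x = cos c * (y - x).
  move=> xy; apply: MVT => //; exact/continuous_subspaceT/continuous_sin.
have [lt_uv|lt_vu] := ltP u v.
  have [c] := sinE _ _ lt_uv; rewrite in_itv/= => /andP[uc cv] ce.
  have : cos c < cos u by rewrite ltr_cos// in_itv/=; lra.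
  by nra.
have {}lt_vu : v < u by rewrite lt_neqAle eq_sym uv.
have [c] := sinE _ _ lt_vu; rewrite in_itv/= => /andP[uc cv] ce.
have : cos u < cos c by rewrite ltr_cos// in_itv/=; lra.
by nra.
Qed.

End Trigonometry.

(** * The curvature inequality *)

Lemma abs_mean_curvatureE {R : realType} (theta : R -> R) (s : R) : 0 < curve_x theta s ->
  `|mean_curvature theta s| * (2 * pi * curve_x theta s) =
  pi * `|sin (theta s) + derive1 theta s * curve_x theta s|.
Proof.
move=> x0.
have -> : 2 * pi * curve_x theta s = `|2 * pi * curve_x theta s|.
  by rewrite ger0_norm// !mulr_ge0 ?pi_ge0// ltW.
have -> : pi * `|sin (theta s) + derive1 theta s * curve_x theta s| =
    `|pi * (sin (theta s) + derive1 theta s * curve_x theta s)|.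
  by rewrite normrM (ger0_norm (pi_ge0 R)).
rewrite -normrM /mean_curvature /kappa1 /kappa2; congr `|_|.
by field; rewrite gt_eqF.
Qed.

Section MainInequality.
Context {R : realType} (S : axisym_surface R).
Local Notation mu := (@lebesgue_measure R).
Local Notation L := (len S).
Local Notation theta := (angle S).
Local Notation x := (curve_x theta).
Let folded s := acos (cos (theta s)).
Let phi s : R := pi / L * s.

Definition sphere_defect s : R :=
  sin (folded s) - folded s * cos (theta s)
  - (sin (phi s) - phi s * cos (theta s)).

Let L0 : 0 < L. Proof. exact: length_gt0 (admissible_angle S). Qed.

Let lip_theta : [lipschitz theta s | s in `[0, L]].
Proof. exact: angle_lipschitz (admissible_angle S). Qed.

Let cos_theta_continuous : {within `[0, L], continuous (cos \o theta)}.
Proof.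
have /lipschitzP[M /lipschitz_within_continuous ct] := lip_theta.
by apply: within_continuous_comp ct => t _; exact: continuous_cos.
Qed.

Let lip_folded : [lipschitz folded s | s in `[0, L]].
Proof.
have /lipschitzP[M tM] := lip_theta; apply/lipschitzP; exists M => s t sL tL.
by rewrite (le_trans (acos_cos_lipschitz _ _))// tM.
Qed.

Let lip_x : [lipschitz x s | s in `[0, L]].
Proof.
apply/lipschitzP; exists 1 => s t sL tL; rewrite mul1r.
apply: (primitive_lipschitz (ltW L0) cos_theta_continuous) => // u.
exact: cos_max.
Qed.

Let x0 : x 0 = 0. Proof. exact: curve_x_start (admissible_angle S). Qed.
Let xL : x L = 0. Proof. exact: curve_x_end (admissible_angle S). Qed.

Let x_ge0 : {in `[0, L], forall s, 0 <= x s <= L}.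
Proof.
move=> s; rewrite in_itv/= => /andP[s0 sL]; apply/andP; split.
  move: s0 sL; rewrite le_eqVlt => /predU1P[<-|s0]; first by rewrite x0.
  rewrite le_eqVlt => /predU1P[->|sL]; first by rewrite xL.
  by apply/ltW/(curve_x_gt0 (admissible_angle S)); rewrite in_itv/= s0.
have : `|x s - x 0| <= `|s - 0|.
  apply: (primitive_lipschitz (ltW L0) cos_theta_continuous).
  - by move=> u; exact: cos_max.
  - by rewrite in_itv/= s0.
  - by rewrite in_itv/= lexx ltW.
rewrite x0 !subr0 (ger0_norm s0) => /(le_trans (ler_norm _)) xs.
exact: le_trans xs sL.
Qed.

Let phi_itv : {in `[0, L], forall s, 0 <= phi s <= pi}.
Proof.
move=> s; rewrite in_itv/= => /andP[s0 sL].
rewrite /phi mulr_ge0 ?divr_ge0 ?pi_ge0 ?(ltW L0)//=.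
by rewrite mulrAC ler_pdivrMr// ler_wpM2l// pi_ge0.
Qed.

Lemma sphere_defect_ge0 : {in `[0, L], forall s, 0 <= sphere_defect s}.
Proof.
move=> s sL; rewrite subr_ge0.
have := sin_sub_cos_tangent (acos_cos_itv (theta s)) (phi_itv sL).
by rewrite cos_acos_cos => -[].
Qed.

Lemma sphere_defect_eq0 s : s \in `[0, L] -> sphere_defect s = 0 ->
  folded s = phi s.
Proof.
move=> sL /eqP; rewrite subr_eq0 => D0.
have := sin_sub_cos_tangent (acos_cos_itv (theta s)) (phi_itv sL).
by rewrite cos_acos_cos => -[_]; rewrite eq_sym D0 => /esym/eqP.
Qed.

Lemma sphere_defect_continuous : {within `[0, L], continuous sphere_defect}.
Proof.
have /lipschitzP[M /lipschitz_within_continuous cf] := lip_folded.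
have cphi : {within `[0, L], continuous phi}.
  apply: continuous_subspaceT => s.
  by apply: cvgM; [exact: cvg_cst|exact: cvg_id].
have csin f : {within `[0, L], continuous f} ->
    {within `[0, L], continuous (sin \o f)}.
  by move=> cf'; apply: within_continuous_comp cf' => t _; exact: continuous_sin.
move=> s; apply: cvgB; (apply: cvgB; [exact: csin|apply: cvgM]).
- exact: cf.
- exact: cos_theta_continuous.
- exact: cphi.
- exact: cos_theta_continuous.
Qed.

Lemma total_abs_mean_curvature_defect :
  2 * L + pi / (2 * L) * area S + pi * (\int[mu]_(s in `[0, L]) sphere_defect s)
  <= total_abs_mean_curvature S.
Proof.
have aeF : Filter (nbhs (almost_everywhere mu)).
  exact: ae_filter_ringOfSetsType.
have /lipschitzP[K1 tK] := lip_theta.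
have [d [md dK _ aed]] := lipschitz_ae_derivable L0 tK.
have /lipschitzP[K2 fK] := lip_folded.
have [q [mq qK _ aeq]] := lipschitz_ae_derivable L0 fK.
(* The part of the lower bound that is an exact derivative: [sin (phi s)] is the derivative of
   [- (L / pi) * cos (phi s)]. *)
pose F s := (folded s - phi s) * x s - L / pi * cos (pi / L * s).
have lip_F : [lipschitz F s | s in `[0, L]].
  apply: lipschitz_subr.
    apply: lipschitz_mulr; last exact: lip_x.
    by apply: lipschitz_subr; [exact: lip_folded|exact: lipschitz_scale].
  apply: lipschitz_mulr; last exact: lipschitz_cos_scale.
  by apply/lipschitzP; exists 0 => s t _ _; rewrite subrr normr0 mul0r.
have /lipschitzP[K3 FK] := lip_F.
have [e [me eK intE aee]] := lipschitz_ae_derivable L0 FK.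
(* The product with [x] vanishes at both ends, so what remains is [L / pi * (cos 0 - cos pi)]. *)
have {}intE : \int[mu]_(t in `[0, L]) e t = 2 * L / pi.
  rewrite intE /F x0 xL !mulr0 cos0 divfK ?gt_eqF// cospi.
  by ring.
have piN0 : pi != 0 :> R by rewrite gt_eqF// pi_gt0.
have LN0 : L != 0 by rewrite gt_eqF.
pose B s := pi * (e s + pi / L * x s + sphere_defect s).
have ie : mu.-integrable `[0, L] (EFin \o e).
  by apply: (bounded_itv_integrable (C := K3)) => //; exact: measurable_funTS.
have ix : mu.-integrable `[0, L] (EFin \o x).
  apply: within_itv_integrable; apply: primitive_continuous; first exact: ltW.
  exact: cos_theta_continuous.
have iD : mu.-integrable `[0, L] (EFin \o sphere_defect).
  exact/within_itv_integrable/sphere_defect_continuous.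
have ipx : mu.-integrable `[0, L] (EFin \o (fun s => pi / L * x s)).
  refine (@integrableZl_EFin _ _ _ _ _ ix). done.
have iex : mu.-integrable `[0, L] (EFin \o (fun s => e s + pi / L * x s)).
  exact: integrableD_EFin.
have iexD : mu.-integrable `[0, L]
    (EFin \o (fun s => e s + pi / L * x s + sphere_defect s)).
  exact: integrableD_EFin.
have iB : mu.-integrable `[0, L] (EFin \o B).
  exact: integrableZl_EFin.
have areaE : area S = 2 * pi * \int[mu]_(s in `[0, L]) x s.
  rewrite /area /surface_integral -RintegralZl//.
  by apply: eq_Rintegral => s _; rewrite mul1r.
have intB : \int[mu]_(s in `[0, L]) B s = 2 * L + pi / (2 * L) * area S +
    pi * (\int[mu]_(s in `[0, L]) sphere_defect s).
  rewrite RintegralZl// RintegralD// RintegralD// RintegralZl// intE areaE.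
  by move: pi piN0 => p pN0; field; rewrite ?pN0 LN0.
rewrite -intB.
have theta_near (s : R) : 0 < s < L ->
    \forall y \near s, `|theta y - theta s| <= K1 * `|y - s|.
  move=> /andP[s0 sL]; near=> y; apply: tK; rewrite /= in_itv/=.
    by apply/andP; split; apply: ltW; near: y; [exact: lt_nbhsr|exact: lt_nbhsl].
  by rewrite !ltW.
(* The bound must hold at every point. Where [x] vanishes the integrand is zero; elsewhere
   [|sin| <= 1], [x <= L], and [derive1] is bounded by the Lipschitz constant or equals the default
   [point]. *)
have [C hC] : exists C, {in `[0, L], forall s : R,
    0 <= `|mean_curvature theta s| * (2 * pi * x s) <= C}.
  exists (pi * (1 + (`|K1| + `|point : R|) * L)) => s sL.
  have /andP[xs0 xsL] := x_ge0 sL.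
  rewrite mulr_ge0 ?mulr_ge0 ?pi_ge0//=.
  have [xs|xs] := eqVneq (x s) 0.
    by rewrite xs !mulr0 mulr_ge0 ?pi_ge0// addr_ge0// mulr_ge0 ?addr_ge0// ltW.
  rewrite abs_mean_curvatureE ?lt_neqAle 1?eq_sym ?xs// ler_wpM2l ?pi_ge0//.
  rewrite (le_trans (ler_normD _ _))// lerD ?sin_max// normrM (ger0_norm xs0).
  apply: ler_pM => //; apply: derive1_lipschitz_le.
  have s0L : 0 < s < L.
    move: sL; rewrite in_itv/= !le_eqVlt => /andP[/predU1P[s0|->]].
      by rewrite -s0 x0 eqxx in xs.
    by move=> /predU1P[s0|->//]; rewrite s0 xL eqxx in xs.
  exact: theta_near.
apply: (ae_le_Rintegral_itv iB hC).
apply: filterS3 aed aeq aee => s td fq Fe /[dup] s0L /andP[s0 sL].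
have {}td := td s0L; have {}fq := fq s0L; have {}Fe := Fe s0L.
have xs : 0 < x s.
  by apply: (curve_x_gt0 (admissible_angle S)); rewrite in_itv/= s0.
have dq : `|q s| <= `|d s|.
  by apply: derivative_le td fq _; near=> y; exact: acos_cos_lipschitz.
(* Differentiating [cos folded = cos theta] gives this identity with no case distinction on the sign
   or the vanishing of [sin (theta s)]. *)
have sdq : sin (folded s) * q s = sin (theta s) * d s.
  have := is_derive1_comp (is_derive_cos (folded s)) fq.
  have -> : cos \o folded = cos \o theta by apply/funext => t; exact: cos_acos_cos.
  have := is_derive1_comp (is_derive_cos (theta s)) td.
  by move=> [_ d1] [_]; rewrite d1 !mulNr => /oppr_inj.
have eE : e s = (q s - pi / L) * x s + (folded s - phi s) * cos (theta s)
    + sin (phi s).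
  have dphi : is_derive s 1 phi (pi / L).
    rewrite -[X in is_derive _ _ _ X]mulr1.
    exact: (@is_deriveZ _ _ _ id (pi / L)).
  have dx := is_derive_primitive cos_theta_continuous s0L.
  have dcos := is_derive1_comp (is_derive_cos (phi s)) dphi.
  have := is_deriveB (is_deriveM (is_deriveB fq dphi) dx)
    (@is_deriveZ _ _ _ _ (L / pi) _ _ _ dcos).
  have -> : (folded - phi) * (fun z => \int[mu]_(t in `[0, z]) (cos \o theta) t)
     - L / pi \*: (cos \o phi) = F by [].
  move=> [_ FE]; move: Fe => [_ <-]; rewrite FE /GRing.scale/= !fctE.
  by rewrite -[\int[_]_(_ in _) _]/(x s) /phi; move: pi piN0 => p pN0; field; rewrite ?pN0 LN0.
have -> : `|mean_curvature theta s| * (2 * pi * x s) =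
    pi * `|sin (theta s) + d s * x s|.
  by rewrite abs_mean_curvatureE// derive1E (derive_val (is_derive := td)).
rewrite /B ler_pM2l ?pi_gt0//.
have -> : e s + pi / L * x s + sphere_defect s = sin (folded s) + q s * x s.
  by rewrite eE /sphere_defect; ring.
(* Comparing squares suffices: the sines have equal squares, the mixed terms agree by [sdq], and the
   remaining squares compare by [dq]. *)
apply: le_trans (ler_norm _) _; rewrite -ler_sqr ?nnegrE// !real_normK ?num_real//.
have sff : sin (folded s) ^+ 2 = sin (theta s) ^+ 2.
  by rewrite sin_acos_cos real_normK ?num_real.
have qd2 : (q s * x s) ^+ 2 <= (d s * x s) ^+ 2.
  rewrite !exprMn ler_wpM2r ?sqr_ge0// -(real_normK (num_real (q s))).
  by rewrite -(real_normK (num_real (d s))) ler_sqr ?nnegrE.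
rewrite !sqrrD sff lerD// lerD2l lerMn2r/=.
by rewrite mulrA sdq mulrA.
Unshelve. all: by end_near. Qed.

End MainInequality.

(** * The lower bound by the area and its equality case *)

Section Equality.
Context {R : realType}.
Local Notation mu := (@lebesgue_measure R).

(** The primitive of [f] is nondecreasing, starts at 0 and ends at most at 0, so it is constant and
    its derivative [f] vanishes. Continuity yields this at every interior point, as needed for the
    sphere defect. *)
Lemma ge0_Rintegral0_eq0 (f : R -> R) (L : R) : 0 < L ->
  {within `[0, L], continuous f} -> {in `[0, L], forall s, 0 <= f s} ->
  \int[mu]_(s in `[0, L]) f s <= 0 -> {in `]0, L[, forall s, f s = 0}.
Proof.
move=> L0 cf f0 intf s; rewrite in_itv/= => /andP[s0 sL].
pose P (x : R) := \int[mu]_(t in `[0, x]) f t.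
have cP : {within `[0, L], continuous P}.
  exact: primitive_continuous (ltW L0) cf.
have Pnd x y : 0 <= x -> x <= y -> y <= L -> P x <= P y.
  move=> x0 xy yL.
  have [c + E] : exists2 c, c \in `[x, y] & P y - P x = f c * (y - x).
    apply: (@MVT_segment _ P f) => //.
      move=> c; rewrite in_itv/= => /andP[xc cy].
      apply: is_derive_primitive cf _.
      by rewrite (le_lt_trans x0 xc) (lt_le_trans cy yL).
    by apply: continuous_subspaceW cP; apply: subset_itv; rewrite bnd_simp.
  rewrite in_itv/= => /andP[xc cy]; rewrite -subr_ge0 E mulr_ge0 ?subr_ge0// f0//.
  by rewrite in_itv/= (le_trans x0 xc) (le_trans cy yL).
have P0 : P 0 = 0 by rewrite /P set_itv1 Rintegral_set1.
have PE y : 0 < y < L -> P y = 0.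
  move=> /andP[y0 yL]; apply/eqP; rewrite eq_le; apply/andP; split.
    by apply: le_trans intf; exact: (Pnd _ _ (ltW y0) (ltW yL) (lexx L)).
  by rewrite -P0; exact: (Pnd _ _ (lexx 0) (ltW y0) (ltW yL)).
have s0L : 0 < s < L by rewrite s0.
have [_ <-] := is_derive_primitive cf s0L.
have cst0 : \forall y \near s, cst 0 y = P y.
  near=> y; rewrite PE//.
  by apply/andP; split; near: y; [exact: lt_nbhsr|exact: lt_nbhsl].
by have [_] := near_eq_is_derive cst0 (is_derive_cst (0 : R) s 1).
Unshelve. all: by end_near. Qed.

End Equality.

Section AngleDetermined.
Context {R : realType} (S : axisym_surface R).
Local Notation mu := (@lebesgue_measure R).
Local Notation L := (len S).
Local Notation theta := (angle S).

Lemma angle_continuous : {within `[0, L], continuous theta}.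
Proof.
have /lipschitzP[M] := angle_lipschitz (admissible_angle S).
exact: lipschitz_within_continuous.
Qed.

(** The angle runs from 0 to [pi]. If it were at most 0 at an interior point it would take the value
    0 there or later, and if it were at least [pi] it would take the value [pi] there or earlier;
    either gives an interior zero of the sine. *)
Lemma angle_range : {in `]0, L[, forall s, sin (theta s) != 0} ->
  {in `]0, L[, forall s, 0 < theta s < pi}.
Proof.
move=> sN0 s; rewrite in_itv/= => /andP[s0 sL].
have t0 := angle_start (admissible_angle S).
have tL := angle_end (admissible_angle S).
have ct (a b : R) : 0 <= a -> b <= L -> {within `[a, b], continuous theta}.
  move=> a0 bL; apply: continuous_subspaceW angle_continuous.
  by apply: subset_itv; rewrite bnd_simp.
have ts : sin (theta s) != 0 by rewrite sN0// in_itv/= s0.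
rewrite !ltNge; apply/andP; split; apply/negP => tle.
  have [||u] := @IVT _ theta s L 0 (ltW sL).
  - by apply: ct => //; exact: ltW.
  - by rewrite tL ge_min tle le_max pi_ge0 orbT.
  rewrite in_itv/= !le_eqVlt => /andP[/predU1P[<-|su]].
    by move=> _ tu; rewrite tu sin0 eqxx in ts.
  move=> /predU1P[->|uL]; first by rewrite tL => /eqP; rewrite gt_eqF// pi_gt0.
  by move=> tu; have := sN0 u; rewrite in_itv/= (lt_trans s0 su) uL tu sin0 eqxx => /(_ isT).
have [||u] := @IVT _ theta 0 s pi (ltW s0).
- by apply: ct => //; exact: ltW.
- by rewrite t0 ge_min pi_ge0 le_max tle orbT.
rewrite in_itv/= !le_eqVlt => /andP[/predU1P[<-|u0]].
  by move=> _ /esym/eqP; rewrite t0 gt_eqF// pi_gt0.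
move=> /predU1P[->|us]; first by move=> tu; rewrite tu sinpi eqxx in ts.
by move=> tu; have := sN0 u; rewrite in_itv/= u0 (lt_trans us sL) tu sinpi eqxx => /(_ isT).
Qed.

Lemma sqrt_area_le : Num.sqrt (4 * pi * area S) <= 2 * L + pi / (2 * L) * area S.
Proof.
have L0 := length_gt0 (admissible_angle S).
have A0 : 0 <= area S.
  apply: Rintegral_ge0 => s; rewrite /= in_itv/= mul1r => /andP[].
  rewrite le_eqVlt => /predU1P[<- _|s0].
    by rewrite (curve_x_start (admissible_angle S)) mulr0.
  rewrite le_eqVlt => /predU1P[->|sL].
    by rewrite (curve_x_end (admissible_angle S)) mulr0.
  rewrite mulr_ge0 ?mulr_ge0 ?pi_ge0// ltW//.
  by apply: (curve_x_gt0 (admissible_angle S)); rewrite in_itv/= s0.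
have b0 : 0 <= 2 * L + pi / (2 * L) * area S.
  by rewrite addr_ge0 ?mulr_ge0 ?invr_ge0 ?mulr_ge0 ?pi_ge0// ltW.
rewrite -[leRHS](ger0_norm b0) -sqrtr_sqr ler_wsqrtr//.
have -> : 4 * pi * area S = 4 * (2 * L * (pi / (2 * L) * area S)).
  by move: (pi : R) => p; field; rewrite gt_eqF.
set u := 2 * L; set v := _ * area S.
rewrite -subr_ge0 (_ : _ - _ = (u - v) ^+ 2) ?sqr_ge0//; ring.
Qed.

Lemma sqrt_area_le_total_abs_mean_curvature :
  Num.sqrt (4 * pi * area S) <= total_abs_mean_curvature S.
Proof.
apply: le_trans sqrt_area_le (le_trans _ (total_abs_mean_curvature_defect S)).
rewrite lerDl mulr_ge0 ?pi_ge0//; apply: Rintegral_ge0 => s sL.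
exact: sphere_defect_ge0.
Qed.

(** The radius [L / pi] is that of the sphere whose meridian has length [L]. *)
Lemma angle_of_equality :
  total_abs_mean_curvature S = Num.sqrt (4 * pi * area S) ->
  {in `[0, L], forall s, theta s = s / (L / pi)}.
Proof.
move=> E; have L0 := length_gt0 (admissible_angle S).
have D0 : \int[mu]_(s in `[0, L]) sphere_defect S s <= 0.
  have := total_abs_mean_curvature_defect S.
  rewrite E => /le_trans /(_ sqrt_area_le); rewrite gerDl.
  by rewrite pmulr_rle0// pi_gt0.
have cE : {in `]0, L[, forall s, acos (cos (theta s)) = s / (L / pi)}.
  move=> s s0L; have s0L' : s \in `[0, L] by exact: subset_itv_oo_cc s0L.
  rewrite (sphere_defect_eq0 s0L'); last first.
    apply: (ge0_Rintegral0_eq0 L0 _ _ D0) s0L.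
    - exact: sphere_defect_continuous.
    - exact: sphere_defect_ge0.
  by rewrite invf_div mulrC.
have phi0 s : 0 < s < L -> 0 < s / (L / pi) < pi.
  move=> /andP[s0 sL]; rewrite !divr_gt0 ?pi_gt0//=.
  by rewrite ltr_pdivrMr ?divr_gt0 ?pi_gt0// mulrCA divff ?mulr1// gt_eqF ?pi_gt0.
have range := angle_range.
(* The folded angle equals [phi], which lies strictly between 0 and [pi], so [|sin theta|] is
   positive; [theta] then stays in []0, pi[], where folding is the identity. *)
have {}range : {in `]0, L[, forall s, 0 < theta s < pi}.
  apply: range => s s0L; have := phi0 s; rewrite -cE//.
  rewrite in_itv/= in s0L => /(_ s0L) /sin_gt0_pi.
  by rewrite sin_acos_cos normr_gt0.
move=> s; rewrite in_itv/= !le_eqVlt => /andP[/predU1P[<-|s0]].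
  by rewrite mul0r (angle_start (admissible_angle S)).
move=> /predU1P[->|sL].
  by rewrite (angle_end (admissible_angle S)) invf_div mulrCA divff ?mulr1// gt_eqF.
have s0L : s \in `]0, L[ by rewrite in_itv/= s0.
by rewrite -cE// cosK//; have /andP[? ?] := range _ s0L; rewrite in_itv/= !ltW.
Qed.

End AngleDetermined.

(** * Spheres *)

Section RoundSphere.
Context {R : realType}.
Local Notation mu := (@lebesgue_measure R).

Lemma Rintegral_FTC (G g : R -> R) (a b : R) : a <= b ->
  (forall s : R, is_derive s 1 G (g s)) -> continuous g ->
  \int[mu]_(s in `[a, b]) g s = G b - G a.
Proof.
rewrite le_eqVlt => /predU1P[<- _ _|ab dG cg].
  by rewrite set_itv1 Rintegral_set1 subrr.
have cG : continuous G.
  move=> s; apply: differentiable_continuous; apply/derivable1_diffP.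
  by have [] := dG s.
rewrite /Rintegral (@continuous_FTC2 _ g G)//.
- exact: continuous_subspaceT.
- split; [by move=> s _; have [] := dG s|exact/cvg_at_right_filter/cG|exact/cvg_at_left_filter/cG].
- by move=> s _; rewrite derive1E; have [] := dG s.
Qed.

Lemma continuous_sin_div (r : R) : continuous (fun s : R => sin (s / r)).
Proof.
move=> s; apply: (@continuous_comp _ _ _ (fun s : R => s / r) sin); last exact: continuous_sin.
by apply: cvgM; [exact: cvg_id|exact: cvg_cst].
Qed.

Lemma continuous_cos_div (r : R) : continuous (fun s : R => cos (s / r)).
Proof.
move=> s; apply: (@continuous_comp _ _ _ (fun s : R => s / r) cos); last exact: continuous_cos.
by apply: cvgM; [exact: cvg_id|exact: cvg_cst].
Qed.

Let is_derive_div (r s : R) : is_derive s 1 (fun s : R => s / r) r^-1.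
Proof.
have -> : (fun s : R => s / r) = r^-1 \*: id by apply/funext => u /=; rewrite mulrC.
by rewrite -[X in is_derive _ _ _ X]mulr1; exact: is_deriveZ.
Qed.

Lemma Rintegral_sin_div (r a b : R) : r != 0 -> a <= b ->
  \int[mu]_(s in `[a, b]) sin (s / r) = r * (cos (a / r) - cos (b / r)).
Proof.
move=> r0 ab.
have dG (s : R) : is_derive s 1 (- r \*: (cos \o (fun s : R => s / r))) (sin (s / r)).
  have := is_deriveZ (- r)
    (@is_derive1_comp _ cos (fun s : R => s / r) _ _ _ (is_derive_cos (s / r))
      (is_derive_div r s)).
  by move=> /is_derive_eq; apply; rewrite /GRing.scale/=; field.
rewrite (Rintegral_FTC ab dG); last exact: continuous_sin_div.
by rewrite !fctE/= /GRing.scale/=; ring.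
Qed.

Lemma Rintegral_cos_div (r a b : R) : r != 0 -> a <= b ->
  \int[mu]_(s in `[a, b]) cos (s / r) = r * (sin (b / r) - sin (a / r)).
Proof.
move=> r0 ab.
have dG (s : R) : is_derive s 1 (r \*: (sin \o (fun s : R => s / r))) (cos (s / r)).
  have := is_deriveZ (r)
    (@is_derive1_comp _ sin (fun s : R => s / r) _ _ _ (is_derive_sin (s / r))
      (is_derive_div r s)).
  by move=> /is_derive_eq; apply; rewrite /GRing.scale/=; field.
rewrite (Rintegral_FTC ab dG); last exact: continuous_cos_div.
by rewrite !fctE/= /GRing.scale/=; ring.
Qed.

Lemma round_curve (r L : R) (theta : R -> R) : r != 0 ->
  {in `[0, L], forall s, theta s = s / r} ->
  {in `[0, L], forall s, curve theta s = (r * sin (s / r), r * (1 - cos (s / r)))}.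
Proof.
move=> r0 tE s; rewrite in_itv/= => /andP[s0 sL].
have tE' : {in (`[0, s]%classic : set R), forall t, theta t = t / r}.
  move=> t; rewrite inE/= in_itv/= => /andP[t0 ts].
  by rewrite tE// in_itv/= t0 (le_trans ts sL).
rewrite /curve /curve_x /curve_z; congr (_, _).
  transitivity (\int[mu]_(t in `[0, s]) cos (t / r)).
    by apply: eq_Rintegral => t /tE' /= ->.
  by rewrite Rintegral_cos_div// mul0r sin0 subr0.
transitivity (\int[mu]_(t in `[0, s]) sin (t / r)).
  by apply: eq_Rintegral => t /tE' /= ->.
by rewrite Rintegral_sin_div// mul0r cos0.
Qed.

Lemma round_curve_x (r L : R) (theta : R -> R) : r != 0 ->
  {in `[0, L], forall s, theta s = s / r} ->
  {in `[0, L], forall s, curve_x theta s = r * sin (s / r)}.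
Proof. by move=> r0 tE s sL; have [] := round_curve r0 tE sL. Qed.

Lemma round_curve_z (r L : R) (theta : R -> R) : r != 0 ->
  {in `[0, L], forall s, theta s = s / r} ->
  {in `[0, L], forall s, curve_z theta s = r * (1 - cos (s / r))}.
Proof. by move=> r0 tE s sL; have [] := round_curve r0 tE sL. Qed.

Lemma polar_coordinates (x y : R) : exists2 t : R, t \in `[0, 2 * pi[ &
  x = Num.sqrt (x ^+ 2 + y ^+ 2) * cos t /\
  y = Num.sqrt (x ^+ 2 + y ^+ 2) * sin t.
Proof.
set r := Num.sqrt _.
have r2 : r ^+ 2 = x ^+ 2 + y ^+ 2 by rewrite sqr_sqrtr// addr_ge0 ?sqr_ge0.
have [r0|rN0] := eqVneq r 0.
  exists 0; first by rewrite in_itv/= lexx mulr_gt0// pi_gt0.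
  move: r2; rewrite r0 expr0n/= => /esym/eqP; rewrite paddr_eq0 ?sqr_ge0//.
  by rewrite !sqrf_eq0 => /andP[/eqP-> /eqP->]; rewrite !mul0r.
have r0 : 0 < r by rewrite lt_neqAle eq_sym rN0 sqrtr_ge0.
have xr : -1 <= x / r <= 1.
  rewrite -ler_norml normrM normfV (gtr0_norm r0) ler_pdivrMr// mul1r.
  by rewrite -(ger0_norm (ltW r0)) -ler_sqr ?nnegrE// !real_normK ?num_real// r2 lerDl sqr_ge0.
have a0 := acos_ge0 xr; have api := acos_lepi xr.
have ca : cos (acos (x / r)) = x / r by rewrite acosK// in_itv.
have sa : r * sin (acos (x / r)) = `|y|.
  rewrite sin_acos// -sqrtr_sqr -{1}(gtr0_norm r0) -sqrtr_sqr -sqrtrM ?sqr_ge0//.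
  congr Num.sqrt; rewrite mulrBr mulr1 r2 expr_div_n r2 mulrCA divff ?mulr1; first by ring.
  by rewrite -r2 expf_neq0.
have [y0|y0] := leP 0 y.
  exists (acos (x / r)).
    rewrite in_itv/= a0 (le_lt_trans api)// mulr_natl mulr2n ltrDl pi_gt0//.
  by rewrite sa ca ger0_norm// mulrCA divff// mulr1.
(* Reflection reverses the sign of the sine. The angle stays strictly below [2 * pi], because
   [acos (x / r) = 0] would force [y = 0]. *)
exists (2 * pi - acos (x / r)).
  rewrite in_itv/= subr_ge0 ltrBlDr ltrDl; apply/andP; split.
    by rewrite (le_trans api)// mulr_natl mulr2n lerDl pi_ge0.
  rewrite lt_neqAle a0 andbT; apply/eqP => a00.
  by move: sa; rewrite -a00 sin0 mulr0 => /esym/eqP; rewrite normr_eq0 lt_eqF.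
rewrite mulr_natl cosB sinB cos2pi sin2pi !mul1r !mul0r addr0 sub0r mulrN sa ca.
by rewrite ltr0_norm// opprK mulrCA divff// mulr1.
Qed.

Variable (S : axisym_surface R) (r : R).
Local Notation L := (len S).
Local Notation theta := (angle S).
Hypotheses (r0 : 0 < r) (tE : {in `[0, L], forall s, theta s = s / r}).

Let rN0 : r != 0. Proof. by rewrite gt_eqF. Qed.

Let L0 : 0 < L. Proof. exact: length_gt0 (admissible_angle S). Qed.

Lemma round_len : L = pi * r.
Proof.
have := angle_end (admissible_angle S); rewrite tE ?in_itv/= ?lexx ?ltW//.
by move=> <-; rewrite divfK.
Qed.

Lemma round_area : area S = 4 * pi * r ^+ 2.
Proof.
rewrite /area /surface_integral.
transitivity (\int[mu]_(s in `[0, L]) (2 * pi * r * sin (s / r))).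
  by apply: eq_Rintegral => s; rewrite inE => sL; rewrite mul1r (round_curve_x rN0 tE)// mulrA.
rewrite RintegralZl//; last first.
  exact/within_itv_integrable/continuous_subspaceT/continuous_sin_div.
rewrite Rintegral_sin_div ?(ltW L0)// round_len mulfK// cospi mul0r cos0.
by ring.
Qed.

Lemma round_total_abs_mean_curvature : total_abs_mean_curvature S = 4 * pi * r.
Proof.
rewrite /total_abs_mean_curvature /surface_integral.
transitivity (\int[mu]_(s in `[0, L]) (2 * pi * sin (s / r))).
  apply: eq_Rintegral => s; rewrite inE/= => sL; have xE := round_curve_x rN0 tE sL.
  (* At the two poles the factor [x] annihilates whatever default values the curvatures take. *)
  move: (sL); rewrite in_itv/= le_eqVlt => /andP[/predU1P[s0 _|s0]].
    by rewrite xE -s0 mul0r sin0 !mulr0.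
  rewrite le_eqVlt => /predU1P[sE|sL'].
    by rewrite xE sE round_len mulfK// sinpi !mulr0.
  have sx : 0 < curve_x theta s.
    by apply: (curve_x_gt0 (admissible_angle S)); rewrite in_itv/= s0.
  rewrite abs_mean_curvatureE//.
  have -> : derive1 theta s = r^-1.
    rewrite derive1E.
    have near_tE : \forall y \near s, y / r = theta y.
      near=> y; rewrite tE// in_itv/=; apply/andP; split; apply: ltW; near: y.
        exact: lt_nbhsr.
      exact: lt_nbhsl.
    by have [_ ->] := near_eq_is_derive near_tE (is_derive_div r s).
  have ss : 0 < sin (s / r) by rewrite -(pmulr_rgt0 _ r0) -xE.
  by rewrite tE// xE mulKf// ger0_norm ?addr_ge0 ?ltW//; ring.
rewrite RintegralZl//; last first.
  exact/within_itv_integrable/continuous_subspaceT/continuous_sin_div.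
rewrite Rintegral_sin_div ?(ltW L0)// round_len mulfK// cospi mul0r cos0.
by ring.
Unshelve. all: by end_near. Qed.

Lemma round_carrier : carrier S = axial_sphere r.
Proof.
have xE := round_curve_x rN0 tE; have zE := round_curve_z rN0 tE.
apply/seteqP; split => [_ [[s t] [/= sL _] <-]|[[x y] z] /=].
  rewrite /axial_sphere /rotation/= xE// zE//.
  have := cos2Dsin2 (s / r); have := cos2Dsin2 t.
  move: (cos t) (sin t) (cos (s / r)) (sin (s / r)) => a b c d ab cd.
  transitivity (r ^+ 2 * (c ^+ 2 + (a ^+ 2 + b ^+ 2) * d ^+ 2)); first by ring.
  by rewrite ab mul1r cd mulr1.
rewrite /axial_sphere /= => xyz.
have [t t0 [xt yt]] := polar_coordinates x y.
have zr : -1 <= (r - z) / r <= 1.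
  rewrite -ler_norml normrM normfV (gtr0_norm r0) ler_pdivrMr// mul1r.
  rewrite -[leRHS](ger0_norm (ltW r0)) -ler_sqr ?nnegrE// !real_normK ?num_real//.
  have -> : (r - z) ^+ 2 = (z - r) ^+ 2 by ring.
  by rewrite -xyz lerDr addr_ge0 ?sqr_ge0.
have a0 := acos_ge0 zr; have api := acos_lepi zr.
(* This arc length solves [z = r * (1 - cos (s / r))]. *)
have sL : r * acos ((r - z) / r) \in `[0, L].
  by rewrite in_itv/= round_len mulr_ge0 ?(ltW r0)//= mulrC ler_wpM2r ?(ltW r0).
have ca : cos (acos ((r - z) / r)) = (r - z) / r by rewrite acosK// in_itv.
have sa : r * sin (acos ((r - z) / r)) = Num.sqrt (x ^+ 2 + y ^+ 2).
  rewrite sin_acos// -{1}(gtr0_norm r0) -sqrtr_sqr -sqrtrM ?sqr_ge0//.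
  by congr Num.sqrt; rewrite mulrBr mulr1 -exprMn mulrCA divff// mulr1 -xyz; ring.
exists (r * acos ((r - z) / r), t); first by split.
rewrite /rotation/= xE// zE// [r * acos _]mulrC mulfK// sa -xt -yt ca.
by congr (_, _, _); field.
Qed.

End RoundSphere.

(** * Recovering the angle from a spherical carrier *)

Section SphereParametrization.
Context {R : realType} (S : axisym_surface R) (r : R).
Local Notation L := (len S).
Local Notation theta := (angle S).
Local Notation x := (curve_x theta).
Local Notation z := (curve_z theta).
Hypotheses (r0 : 0 < r) (carrierE : carrier S = axial_sphere r).

Let L0 : 0 < L. Proof. exact: length_gt0 (admissible_angle S). Qed.

Let rN0 : r != 0. Proof. by rewrite gt_eqF. Qed.

Let cos_continuous : {within `[0, L], continuous (cos \o theta)}.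
Proof.
by apply: within_continuous_comp (@angle_continuous _ S) => t _; exact: continuous_cos.
Qed.

Let sin_continuous : {within `[0, L], continuous (sin \o theta)}.
Proof.
by apply: within_continuous_comp (@angle_continuous _ S) => t _; exact: continuous_sin.
Qed.

Let curve_circle : {in `[0, L], forall s, x s ^+ 2 + (z s - r) ^+ 2 = r ^+ 2}.
Proof.
move=> s sL; have : carrier S (rotation theta (s, 0)).
  by exists (s, 0) => //; split => //=; rewrite in_itv/= lexx mulr_gt0// pi_gt0.
by rewrite carrierE /axial_sphere/= cos0 sin0 mulr1 mulr0 expr0n addr0.
Qed.

(** Half the derivative of the circle equation: the radius is orthogonal to the unit tangent. *)
Let tangent (s : R) : 0 < s < L -> x s * cos (theta s) + (z s - r) * sin (theta s) = 0.
Proof.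
move=> s0L.
have dx : is_derive s 1 x (cos (theta s)) := is_derive_primitive cos_continuous s0L.
have dz : is_derive s 1 z (sin (theta s)) := is_derive_primitive sin_continuous s0L.
have dzr : is_derive s 1 (z - cst r) (sin (theta s)).
  by have := is_deriveB dz (is_derive_cst r s 1); rewrite subr0.
have dE := is_deriveD (is_deriveM dx dx) (is_deriveM dzr dzr).
have near_cst : \forall y \near s, cst (r ^+ 2) y =
    (x * x + (z - cst r) * (z - cst r)) y.
  have /andP[s0 sL] := s0L.
  near=> y; rewrite -[RHS]/(x y * x y + (z y - r) * (z y - r)) -!expr2.
  rewrite curve_circle//= in_itv/=.
  by apply/andP; split; apply: ltW; near: y; [exact: lt_nbhsr|exact: lt_nbhsl].
have [_ cE] := near_eq_is_derive near_cst (is_derive_cst (r ^+ 2) s 1).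
have [_] := dE; rewrite cE /GRing.scale/= !fctE.
lra.
Unshelve. all: by end_near. Qed.

(* The signed distance from the center of the sphere to the tangent line. *)
Let w s := x s * sin (theta s) - (z s - r) * cos (theta s).

Let w_sqr (s : R) : 0 < s < L -> w s ^+ 2 = r ^+ 2.
Proof.
move=> s0L; have /andP[s0 sL] := s0L.
have := tangent s0L; have := cos2Dsin2 (theta s).
have := @curve_circle s; rewrite in_itv/= !ltW// => /(_ isT); rewrite /w.
move: (x s) (z s - r) (cos (theta s)) (sin (theta s)) => a b c d ab cd acbd.
(* Lagrange's identity. *)
transitivity ((a ^+ 2 + b ^+ 2) * (c ^+ 2 + d ^+ 2) - (a * c + b * d) ^+ 2).
  by ring.
by rewrite ab cd acbd expr0n subr0 mulr1.
Qed.

Let w_continuous : {within `[0, L], continuous w}.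
Proof.
have cx : {within `[0, L], continuous x} by exact: primitive_continuous (ltW L0) _.
have cz : {within `[0, L], continuous z} by exact: primitive_continuous (ltW L0) _.
move=> s; apply: cvgB; apply: cvgM.
- exact: cx.
- exact: sin_continuous.
- by apply: cvgB; [exact: cz|exact: cvg_cst].
- exact: cos_continuous.
Qed.

(** The sign of [w] is fixed at the starting pole, where [w 0 = r]; passing to [- r] would require
    an intermediate zero, excluded by [w_sqr]. *)
Let wE (s : R) : 0 < s < L -> w s = r.
Proof.
move=> s0L; have /andP[s0 sL] := s0L.
have := w_sqr s0L => /eqP; rewrite eqf_sqr => /predU1P[//|/eqP ws].
have w0 : w 0 = r.
  rewrite /w (curve_x_start (admissible_angle S)) (curve_z_start (admissible_angle S)).
  by rewrite (angle_start (admissible_angle S)) cos0 mul0r !sub0r mulNr mulr1 opprK.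
have [||u] := @IVT _ w 0 s 0 (ltW s0).
- by apply: continuous_subspaceW w_continuous; apply: subset_itv; rewrite bnd_simp// ltW.
- by rewrite w0 ws ge_min le_max oppr_le0 (ltW r0) orbT.
rewrite in_itv/= => /andP[u0 us] wu.
have u0L : 0 < u < L.
  rewrite (le_lt_trans us sL) andbT lt_neqAle u0 andbT.
  by apply/eqP => uE; move: wu; rewrite -uE w0 => /eqP; rewrite (negbTE rN0).
by have /esym/eqP := w_sqr u0L; rewrite wu expr0n/= expf_eq0/= (negbTE rN0).
Qed.

(** Tangency and [w = r] give [x = r * sin theta] and [z = r * (1 - cos theta)]. Positivity of [x]
    puts [theta] in []0, pi[], so it equals [acos (1 - z / r)]. This shows that [theta], a priori
    only Lipschitz, is differentiable at every interior point, with constant derivative [r^-1]. *)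
Lemma angle_of_axial_sphere : {in `[0, L], forall s, theta s = s / r}.
Proof.
have xE (s : R) : 0 < s < L -> x s = r * sin (theta s).
  move=> s0L; rewrite -(wE s0L) /w; have := tangent s0L; have := cos2Dsin2 (theta s).
  move: (x s) (z s - r) (cos (theta s)) (sin (theta s)) => a b c d cd acbd.
  transitivity ((c ^+ 2 + d ^+ 2) * a - c * (a * c + b * d)); last by ring.
  by rewrite cd acbd; ring.
have zE (s : R) : 0 < s < L -> cos (theta s) = 1 - z s / r.
  move=> s0L; suff : z s - r = - r * cos (theta s).
    by move=> zr; rewrite -[z s](subrK r) zr; field.
  rewrite -[X in _ = - X * _](wE s0L) /w; have := tangent s0L; have := cos2Dsin2 (theta s).
  move: (x s) (z s - r) (cos (theta s)) (sin (theta s)) => a b c d cd acbd.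
  transitivity ((c ^+ 2 + d ^+ 2) * b - d * (a * c + b * d)); last by ring.
  by rewrite cd acbd; ring.
have sin_gt0 (s : R) : 0 < s < L -> 0 < sin (theta s).
  move=> s0L; rewrite -(pmulr_rgt0 _ r0) -xE//.
  by apply: (curve_x_gt0 (admissible_angle S)); rewrite in_itv.
have range : {in `]0, L[, forall s, 0 < theta s < pi}.
  by apply: angle_range => s; rewrite in_itv/= => /sin_gt0; rewrite lt_neqAle eq_sym => /andP[].
have dtheta (s : R) : 0 < s < L -> is_derive s 1 theta r^-1.
  move=> s0L.
  have near_acos : \forall y \near s, (acos \o (cst 1 - r^-1 \*: z)) y = theta y.
    have /andP[s0 sL] := s0L.
    near=> y.
    have y0L : 0 < y < L.
      by apply/andP; split; near: y; [exact: lt_nbhsr|exact: lt_nbhsl].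
    rewrite -[LHS]/(acos (1 - r^-1 * z y)) mulrC -zE// cosK//.
    by have /andP[? ?] := range y y0L; rewrite in_itv/= !ltW.
  apply: near_eq_is_derive near_acos _.
  have dz : is_derive s 1 z (sin (theta s)) := is_derive_primitive sin_continuous s0L.
  have dg : is_derive s 1 (cst 1 - r^-1 \*: z) (0 - r^-1 *: sin (theta s)).
    by apply: is_deriveB; exact: is_deriveZ.
  have gE : (cst 1 - r^-1 \*: z) s = cos (theta s).
    by rewrite -[LHS]/(1 - r^-1 * z s) mulrC -zE.
  have c1 : -1 < cos (theta s) < 1.
    have := sin_gt0 _ s0L; have := cos2Dsin2 (theta s).
    move: (cos (theta s)) (sin (theta s)) => c d cd d0.
    by apply/andP; split; nra.
  have da : is_derive ((cst 1 - r^-1 \*: z) s) 1 (@acos R)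
      (- (Num.sqrt (1 - cos (theta s) ^+ 2))^-1).
    by rewrite gE; exact: is_derive1_acos.
  have := is_derive1_comp da dg; move/is_derive_eq; apply.
  rewrite -sin2cos2 sqrtr_sqr gtr0_norm ?sin_gt0// /GRing.scale/=.
  by field; rewrite rN0 gt_eqF// sin_gt0.
move=> s; rewrite in_itv/= => /andP[s0 sL].
have [c _] : exists2 c, c \in `[0, s] & theta s - theta 0 = r^-1 * (s - 0).
  apply: (@MVT_segment _ theta (fun=> r^-1)) => //.
    move=> c; rewrite in_itv/= => /andP[c0 cs]; apply: dtheta.
    by rewrite c0 (lt_le_trans cs sL).
  apply: continuous_subspaceW (@angle_continuous _ S).
  by apply: subset_itv; rewrite bnd_simp.
by rewrite (angle_start (admissible_angle S)) !subr0 mulrC.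
Unshelve. all: by end_near. Qed.

End SphereParametrization.

(** * Round spheres as minimizers *)

Lemma admissible_round {R : realType} (r : R) : 0 < r ->
  admissible (pi * r) (fun s => s / r).
Proof.
move=> r0; have rN0 : r != 0 by rewrite gt_eqF.
have L0 : 0 < pi * r by rewrite mulr_gt0// pi_gt0.
have tE : {in `[0, pi * r], forall s : R, s / r = s / r} by [].
have xE := round_curve_x rN0 tE; have zE := round_curve_z rN0 tE.
have in0 : 0 \in `[0, pi * r] by rewrite in_itv/= lexx ltW.
have inL : pi * r \in `[0, pi * r] by rewrite in_itv/= lexx ltW.
have div_itv s : s \in `]0, pi * r[ -> 0 < s / r < pi.
  rewrite in_itv/= => /andP[s0 sL].
  by rewrite divr_gt0// ltr_pdivrMr.
split => //.
- apply/lipschitzP; exists r^-1 => s t _ _.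
  by rewrite -mulrBl normrM mulrC (@ger0_norm _ r^-1)// invr_ge0 ltW.
- by rewrite mul0r.
- by rewrite mulfK.
- by rewrite xE// mul0r sin0 mulr0.
- by rewrite xE// mulfK// sinpi mulr0.
- by rewrite zE// mul0r cos0 subrr mulr0.
- by rewrite zE// mulfK// cospi opprK mulr_gt0// addr_gt0.
(* The height alone separates the points, since [cos] is injective on [[0, pi]]. *)
- move=> s t sL tL []; rewrite !zE ?(subset_itv_oo_cc sL) ?(subset_itv_oo_cc tL)//.
  move=> _ /(mulfI rN0) /addrI /oppr_inj /cos_inj st.
  have /andP[? ?] := div_itv _ sL; have /andP[? ?] := div_itv _ tL.
  by apply: (mulIf (invr_neq0 rN0)); apply: st; rewrite in_itv/= !ltW.
- move=> s sL; rewrite xE ?(subset_itv_oo_cc sL)// mulr_gt0//.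
  exact/sin_gt0_pi/div_itv.
Qed.

Definition round_surface {R : realType} (r : R) (r0 : 0 < r) : axisym_surface R :=
  AxisymSurface (admissible_round r0).

Lemma sqrt_4pi_sphere_area {R : realType} (r : R) : 0 < r ->
  Num.sqrt (4 * pi * (4 * pi * r ^+ 2)) = 4 * pi * r.
Proof.
move=> r0; rewrite (_ : 4 * pi * _ = (4 * pi * r) ^+ 2); last by ring.
by rewrite sqrtr_sqr ger0_norm// !mulr_ge0 ?pi_ge0// ltW.
Qed.

Lemma total_abs_mean_curvature_eqP {R : realType} (S : axisym_surface R) :
  total_abs_mean_curvature S = Num.sqrt (4 * pi * area S) <->
  is_sphere (carrier S).
Proof.
split=> [/angle_of_equality tE|[r r0 carrierE]].
  have r0 : 0 < len S / pi.
    by rewrite divr_gt0 ?pi_gt0//; exact: length_gt0 (admissible_angle S).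
  by exists (len S / pi) => //; exact: round_carrier.
have tE := angle_of_axial_sphere r0 carrierE.
by rewrite (round_area r0 tE) sqrt_4pi_sphere_area// (round_total_abs_mean_curvature r0 tE).
Qed.

Theorem theorem1p3 (R : realType) :
  (forall S : axisym_surface R,
     Num.sqrt (4 * pi * area S) <= total_abs_mean_curvature S /\
     (total_abs_mean_curvature S = Num.sqrt (4 * pi * area S) <->
      is_sphere (carrier S))) /\
  (forall A0 : R, 0 < A0 ->
     exists S0 : axisym_surface R,
       [/\ carrier S0 = axial_sphere (Num.sqrt (A0 / (4 * pi))),
           area S0 = A0,
           total_abs_mean_curvature S0 = Num.sqrt (4 * pi * A0),
           (forall S : axisym_surface R, area S = A0 ->
              total_abs_mean_curvature S0 <= total_abs_mean_curvature S) &
           (forall S : axisym_surface R, area S = A0 ->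
              total_abs_mean_curvature S = total_abs_mean_curvature S0 ->
              carrier S = carrier S0)]).
Proof.
split=> [S|A0 A0_gt0].
  split; first exact: sqrt_area_le_total_abs_mean_curvature.
  exact: total_abs_mean_curvature_eqP.
have pi4 : 0 < 4 * pi :> R by rewrite mulr_gt0// pi_gt0.
set r := Num.sqrt _.
have r0 : 0 < r by rewrite sqrtr_gt0 divr_gt0.
have rE : 4 * pi * r ^+ 2 = A0.
  by rewrite sqr_sqrtr ?divr_ge0 ?ltW// mulrC divfK// gt_eqF.
have tE : {in `[0, len (round_surface r0)], forall s,
    angle (round_surface r0) s = s / r} by [].
have S0 : carrier (round_surface r0) = axial_sphere r by exact: round_carrier.
have areaS0 : area (round_surface r0) = A0 by rewrite (round_area r0 tE).
have totalS0 : total_abs_mean_curvature (round_surface r0) = Num.sqrt (4 * pi * A0).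
  by rewrite (round_total_abs_mean_curvature r0 tE) -rE sqrt_4pi_sphere_area.
exists (round_surface r0); split=> // S areaS.
  by rewrite totalS0 -areaS; exact: sqrt_area_le_total_abs_mean_curvature.
rewrite totalS0 -areaS => /total_abs_mean_curvature_eqP[q q0 Sq].
rewrite S0 Sq; congr axial_sphere.
(* Both spheres have area [A0], which forces [q = r]. *)
have := round_area q0 (angle_of_axial_sphere q0 Sq); rewrite areaS -rE.
by move/(mulfI (lt0r_neq0 pi4))/eqP; rewrite eqrXn2 ?ltW// => /eqP.
Qed.
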